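(* A graph $G$ obtained by edge-pasting together partial cubes $G_1$ and $G_2$ is a partial cube.
   Context: Graphs are simple, undirected, nonempty, and not necessarily finite. For a set $X$, the hypercube $\mathcal H(X)$ is the graph whose vertices are the finite subsets of $X$, with $P,Q$ adjacent iff $|P\Delta Q|=1$. A graph is a partial cube if it can be isometrically embedded (i.e. by a map preserving shortest-path distances) into some $\mathcal H(X)$. Edge-pasting: given connected graphs $G_1=(V_1,E_1)$, $G_2=(V_2,E_2)$ and edges $a_1b_1\in E_1$, $a_2b_2\in E_2$, the graph obtained by edge-pasting is the graph obtained from the disjoint union of $G_1$ and $G_2$ by identifying $a_1$ with $a_2$, $b_1$ with $b_2$, and the edge $a_1b_1$ with the edge $a_2b_2$ (and making no other identifications). *)

(* Defs.v *)
From HB Require Import structures.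
From mathcomp Require Import all_boot finmap.
From mathcomp Require Import boolp classical_sets.
From Stdlib Require Import Relation_Operators.
Set Implicit Arguments.
Unset Strict Implicit.
Unset Printing Implicit Defensive.

Record graph := Graph {
  vertex :> Type;
  adj : rel vertex;
  adj_sym : symmetric adj;
  adj_irr : irreflexive adj;
  vertex_inhabited : inhabited vertex }.

Definition walk (G : graph) (u v : G) (p : seq G) : Prop :=
  path (@adj G) u p /\ last u p = v.

Definition connected (G : graph) : Prop :=
  forall u v : G, exists p, walk u v p.

Definition has_walk (G : graph) (u v : G) (n : nat) : bool :=
  `[< exists2 p, walk u v p & size p = n >].

(* [None] stands for infinite distance. A walk of minimal length repeats no
   vertex, so minimizing over walks is the same as minimizing over paths. *)
Definition dist (G : graph) (u v : G) : option nat :=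
  if pselect (exists n, has_walk u v n) is left ex then Some (ex_minn ex)
  else None.

Definition isometric (G H : graph) (f : G -> H) : Prop :=
  forall u v : G, dist (f u) (f v) = dist u v.

Definition iso (G H : graph) : Prop :=
  exists2 f : G -> H, bijective f & {mono f : u v / adj u v}.

Section Hypercube.
Variable X : choiceType.
Local Open Scope fset_scope.

Definition symdiff (P Q : {fset X}) : {fset X} := (P `\` Q) `|` (Q `\` P).

Definition cube_adj : rel {fset X} := fun P Q => #|` symdiff P Q| == 1%N.

Fact cube_adj_sym : symmetric cube_adj.
Proof. by move=> P Q; rewrite /cube_adj /symdiff fsetUC. Qed.

Fact cube_adj_irr : irreflexive cube_adj.
Proof. by move=> P; rewrite /cube_adj /symdiff fsetDv fsetU0 cardfs0. Qed.

Definition hypercube : graph :=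
  Graph cube_adj_sym cube_adj_irr (inhabits fset0).
End Hypercube.

Definition partial_cube (G : graph) : Prop :=
  exists (X : choiceType) (f : G -> hypercube X), isometric f.

Section DisjointUnion.
Variables G1 G2 : graph.

Definition sum_adj : rel (G1 + G2)%type := fun x y =>
  match x, y with
  | inl u, inl v => adj u v
  | inr u, inr v => adj u v
  | _, _ => false
  end.

Fact sum_adj_sym : symmetric sum_adj.
Proof. by case=> u [] v //=; exact: adj_sym. Qed.

Fact sum_adj_irr : irreflexive sum_adj.
Proof. by case=> u /=; exact: adj_irr. Qed.

Fact sum_inhabited : inhabited (G1 + G2)%type.
Proof. by case: (vertex_inhabited G1) => u; exists; left. Qed.

Definition disjoint_union : graph := Graph sum_adj_sym sum_adj_irr sum_inhabited.
End DisjointUnion.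

Section EdgePasting.
Variables (G1 G2 : graph) (a1 b1 : G1) (a2 b2 : G2).
Variables (e1 : adj a1 b1) (e2 : adj a2 b2).
Local Notation U := (disjoint_union G1 G2).

Inductive glue : U -> U -> Prop :=
  | glue_a : glue (inl a1) (inr a2)
  | glue_b : glue (inl b1) (inr b2).

Definition identified : U -> U -> Prop := clos_refl_sym_trans U glue.

Lemma identifiedE (x y : U) : identified x y <->
  [\/ x = y, glue x y | glue y x].
Proof.
have ne1 : a1 <> b1 by move=> E; move: e1; rewrite E adj_irr.
have ne2 : a2 <> b2 by move=> E; move: e2; rewrite E adj_irr.
split; last first.
  case=> [->|g|g]; [exact: rst_refl|exact: rst_step|].
  exact/rst_sym/rst_step.
elim=> {x y} [x y g|x|x y _ [->|g|g]|x y z _ xy _ yz];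
  [by constructor 2|by constructor 1|by constructor 1|by constructor 3
  |by constructor 2|].
case: xy yz => [-> //|g1|g1] [<-|g2|g2];
  try (by constructor 2); try (by constructor 3);
  constructor 1; inversion g1; subst; inversion g2; congruence.
Qed.

Definition pasted_vertex : Type :=
  {C : set U | exists x, C = identified x}.

Definition pasted_adj : rel pasted_vertex := fun C D =>
  `[< exists x y : U, [/\ sval C x, sval D y & adj x y] >].

Fact pasted_adj_sym : symmetric pasted_adj.
Proof.
move=> C D; apply/asboolP/asboolP => -[x [y [Cx Dy xy]]];
  by exists y, x; split=> //; rewrite adj_sym.
Qed.

Fact pasted_adj_irr : irreflexive pasted_adj.
Proof.
move=> [C [z Cz]]; apply/asboolP => -[x [y [/= zx zy xy]]].
rewrite {}Cz in zx zy.
have /identifiedE[E|g|g] : identified x y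
  by apply: rst_trans zy; exact: rst_sym.
- by move: xy; rewrite E sum_adj_irr.
- by case: g xy.
- by case: g xy.
Qed.

Fact pasted_inhabited : inhabited pasted_vertex.
Proof. by exists; exists (identified (inl a1)), (inl a1). Qed.

Definition pasted_graph : graph :=
  Graph pasted_adj_sym pasted_adj_irr pasted_inhabited.
End EdgePasting.

Definition edge_pasting (G G1 G2 : graph) : Prop :=
  [/\ connected G1, connected G2 &
      exists (a1 b1 : G1) (a2 b2 : G2) (e1 : adj a1 b1) (e2 : adj a2 b2),
        iso G (pasted_graph e1 e2)].

(* Main.v *)
From mathcomp Require Import all_boot finmap.
From mathcomp Require Import boolp classical_sets.
From Stdlib Require Import Relation_Operators.
Require Import Defs.
Set Implicit Arguments.
Unset Strict Implicit.
Unset Printing Implicit Defensive.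

(** Translating by a symmetric difference, embed [G1] and [G2] in hypercubes so
    that [a1] and [a2] go to the empty set, [b1] to [{x1}] and [b2] to [{x2}].
    Identifying the coordinates [x1] and [x2] glues the two embeddings.  If [u]
    is in [G1] and [v] in [G2], then one of the ends of the glued edge lies on a
    geodesic of the cube from [u] to [v]: [b] if [x1] is in the image of [u],
    and [a] otherwise.  Hence a walk of cube-distance length through that end
    joins [u] to [v]; no walk can be shorter as edges go to edges. *)

(** * Calculus of walks and its relation to the distance *)

Section Walks.
Implicit Types G H : graph.

Lemma has_walk0 G (u v : G) : has_walk u v 0 -> u = v.
Proof. by move=> /asboolP[p [_ <-]] /size0nil ->. Qed.

Lemma has_walk1 G (u v : G) : adj u v -> has_walk u v 1.
Proof. by move=> uv; apply/asboolP; exists [:: v] => //; split; rewrite //= uv. Qed.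

Lemma has_walk_cat G (u v w : G) m n :
  has_walk u v m -> has_walk v w n -> has_walk u w (m + n).
Proof.
move=> /asboolP[p [up lp] <-] /asboolP[q [vq lq] <-]; apply/asboolP.
exists (p ++ q); last by rewrite size_cat.
by split; rewrite ?cat_path ?last_cat ?up lp.
Qed.

Lemma has_walk_homo G H (h : G -> H) (u v : G) n :
  {homo h : x y / adj x y} -> has_walk u v n -> has_walk (h u) (h v) n.
Proof.
move=> hadj /asboolP[p [up lp] <-]; apply/asboolP.
exists (map h p); last by rewrite size_map.
by split; [exact: homo_path up | rewrite last_map lp].
Qed.

Lemma has_walk_sym G (u v : G) n : has_walk u v n -> has_walk v u n.
Proof.
move=> /asboolP[p [up <-] <-] {n}; elim: p u up => [|w p IHp] u /=.
  by move=> _; apply/asboolP; exists [::].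
move=> /andP[uw wp]; rewrite -addn1; apply: has_walk_cat (IHp _ wp) _.
by apply: has_walk1; rewrite adj_sym.
Qed.

Lemma dist_eqP G (u v : G) n :
  dist u v = Some n <->
  has_walk u v n /\ (forall m, has_walk u v m -> n <= m).
Proof.
rewrite /dist; case: pselect => [ex|nex]; last first.
  by split=> [//|[uv _]]; case: nex; exists n.
case: ex_minnP => m uvm minm; split=> [[<-] //|[uvn minn]].
by congr Some; apply/eqP; rewrite eqn_leq minm ?minn.
Qed.

End Walks.

(** * Distance and isometric embeddings in the hypercube *)

Section SymmetricDifference.
Variable X : choiceType.
Implicit Types P Q R : {fset X}.
Local Open Scope fset_scope.

Lemma in_symdiff P Q x : (x \in symdiff P Q) = (x \in P) (+) (x \in Q).
Proof. by rewrite !inE; case: (x \in P); case: (x \in Q). Qed.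

Lemma symdiffvv P : symdiff P P = fset0.
Proof. by rewrite /symdiff fsetDv fsetU0. Qed.

Lemma symdiff_eq0 P Q : #|` symdiff P Q| = 0 -> P = Q.
Proof.
move=> /cardfs0_eq PQ0; apply/fsetP => x.
by have := in_symdiff P Q x; rewrite PQ0 inE; case: (x \in P); case: (x \in Q).
Qed.

Lemma symdiff_translate P Q R : symdiff (symdiff P R) (symdiff Q R) = symdiff P Q.
Proof.
apply/fsetP => x; rewrite !in_symdiff.
by case: (x \in P); case: (x \in Q); case: (x \in R).
Qed.

Lemma card_symdiff_triangle P Q R :
  #|` symdiff P R| <= (#|` symdiff P Q| + #|` symdiff Q R|)%N.
Proof.
(* The right-hand side is the size of the union plus that of the intersection, so inclusion in the
   union is enough. *)
rewrite -cardfsUI; apply: leq_trans (leq_addr _ _).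
apply/fsubset_leq_card/fsubsetP => x; rewrite in_fsetU !in_symdiff.
by case: (x \in P); case: (x \in Q); case: (x \in R).
Qed.

(** The hypotheses say that [Q] lies on a geodesic from [P] to [R]: they make the two differences on
    the right disjoint, with union [symdiff P R]. *)
Lemma card_symdiff_between P Q R : P `&` R `<=` Q -> Q `<=` P `|` R ->
  #|` symdiff P R| = (#|` symdiff P Q| + #|` symdiff Q R|)%N.
Proof.
move=> /fsubsetP PRQ /fsubsetP QPR; rewrite -cardfsUI.
have -> : symdiff P Q `&` symdiff Q R = fset0.
  apply/fsetP => x; rewrite inE !in_symdiff inE.
  have := PRQ x; have := QPR x; rewrite !inE.
  case: (x \in P); case: (x \in Q); case: (x \in R) => //=.
    by move=> _ /(_ isT).
  by move=> /(_ isT).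
rewrite cardfs0 addn0; congr #|` _|; apply/fsetP => x.
rewrite in_fsetU !in_symdiff.
have := PRQ x; have := QPR x; rewrite !inE.
case: (x \in P); case: (x \in Q); case: (x \in R) => //=.
  by move=> _ /(_ isT).
by move=> /(_ isT).
Qed.

(** The elements of the symmetric difference are toggled one at a time, by induction on their
    number. *)
Lemma has_walk_cube (P Q : hypercube X) : has_walk P Q #|` symdiff P Q|.
Proof.
move: {2}#|` _| (erefl #|` symdiff P Q|) => n; elim: n P Q => [|n IHn] P Q.
  by move=> PQ0; rewrite (symdiff_eq0 PQ0) symdiffvv cardfs0; apply/asboolP; exists [::].
move=> cPQ; have /fset0Pn[x xPQ] : symdiff P Q != fset0 by rewrite -cardfs_gt0 cPQ.
pose P' : hypercube X := symdiff P [fset x].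
have PP' : symdiff P P' = [fset x].
  by apply/fsetP => y; rewrite !in_symdiff addKb.
have P'Q : symdiff P' Q = symdiff P Q `\ x.
  apply/fsetP => y; rewrite in_fsetD !in_symdiff in_fset1.
  case: eqP => [->|_] /=; last by rewrite addbF.
  by move: xPQ; rewrite in_symdiff; case: (x \in P); case: (x \in Q).
move: (cardfsD1 x (symdiff P Q)); rewrite xPQ -P'Q => ->.
apply: (@has_walk_cat _ _ P').
  by apply: has_walk1; rewrite /= /cube_adj PP' cardfs1.
by apply: IHn; move: (cardfsD1 x (symdiff P Q)); rewrite xPQ cPQ P'Q => -[->].
Qed.

Lemma has_walk_cube_ge (P Q : hypercube X) n : has_walk P Q n -> #|` symdiff P Q| <= n.
Proof.
move=> /asboolP[p [Pp <-] <-] {Q n}; elim: p P Pp => [|Q p IHp] P /=.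
  by rewrite symdiffvv cardfs0.
move=> /andP[/eqP PQ Qp]; apply: leq_trans (card_symdiff_triangle P Q _) _.
by rewrite PQ add1n ltnS IHp.
Qed.

Lemma dist_cube (P Q : hypercube X) : dist P Q = Some #|` symdiff P Q|.
Proof. by apply/dist_eqP; split=> [|m]; [exact: has_walk_cube | exact: has_walk_cube_ge]. Qed.

(** Preserving edges bounds every walk in [G] below by the cube distance, and the given walks attain
    this bound. With this criterion, distances in the pasted graph need not be computed. *)
Lemma isometric_cubeP (G : graph) (f : G -> hypercube X) :
  isometric f <->
  {homo f : u v / adj u v} /\ (forall u v, has_walk u v #|` symdiff (f u) (f v)|).
Proof.
split=> [isof|[fadj fwalk] u v]; last first.
  rewrite dist_cube; apply/esym/dist_eqP; split=> // m uvm.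
  exact/has_walk_cube_ge/(has_walk_homo fadj).
have distf u v : dist u v = Some #|` symdiff (f u) (f v)|.
  by rewrite -isof dist_cube.
split=> [u v uv|u v]; last by have /dist_eqP[] := distf u v.
have /dist_eqP[uvn /(_ _ (has_walk1 uv))] := distf u v.
(* The images of adjacent vertices are at distance at most 1; distance 0 would give [u = v], against
   irreflexivity. *)
rewrite /= /cube_adj leq_eqVlt ltnS leqn0 => /orP[//|/eqP uv0].
by move: uvn uv; rewrite uv0 => /has_walk0 ->; rewrite adj_irr.
Qed.

Lemma isometric_translate (G : graph) (f : G -> hypercube X) (A : {fset X}) :
  isometric f -> isometric (fun u => symdiff (f u) A : hypercube X).
Proof. by move=> isof u v; rewrite dist_cube symdiff_translate -dist_cube isof. Qed.

End SymmetricDifference.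

Section Image.
Variables (X Y : choiceType) (s : X -> Y).
Hypothesis s_inj : injective s.
Local Open Scope fset_scope.

Lemma imfset_symdiff (P Q : {fset X}) :
  symdiff (s @` P) (s @` Q) = s @` (symdiff P Q).
Proof.
apply/fsetP => y; rewrite in_symdiff.
have [[x ->]|ney] := pselect (exists x, y = s x).
  have mem_im (R : {fset X}) : (s x \in s @` R) = (x \in R) by exact: mem_imfset.
  by rewrite !mem_im in_symdiff.
have notin (R : {fset X}) : y \in s @` R = false.
  by apply/negP => /imfsetP[x _ yx]; apply: ney; exists x.
by rewrite !notin.
Qed.

Lemma isometric_imfset (G : graph) (f : G -> hypercube X) :
  isometric f -> isometric (fun u => s @` f u : hypercube Y).
Proof.
move=> isof u v; rewrite dist_cube imfset_symdiff.
by rewrite card_imfset // -dist_cube isof.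
Qed.

End Image.

(** Translating by [f a] sends [a] to the empty set, and the neighbours of the empty set in the cube
    are the singletons. *)
Lemma partial_cube_edge (G : graph) (a b : G) : adj a b -> partial_cube G ->
  exists (X : choiceType) (x : X) (f : G -> hypercube X),
    [/\ isometric f, f a = fset0 & f b = [fset x]%fset].
Proof.
move=> ab [X [f isof]]; pose g u : hypercube X := symdiff (f u) (f a).
have isog : isometric g by exact: isometric_translate.
have /isometric_cubeP[/(_ _ _ ab)] := isog.
have ga : g a = fset0 by exact: symdiffvv.
rewrite /= /cube_adj ga /symdiff fset0D fsetD0 fset0U => /cardfs1P[x gb] _.
by exists X, x, g.
Qed.

Lemma iso_partial_cube (G H : graph) : iso G H -> partial_cube H -> partial_cube G.
Proof.
move=> [h [k hK kK] hadj] [X [f /isometric_cubeP[fadj fwalk]]].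
exists X, (f \o h); apply/isometric_cubeP; split=> [u v uv|u v].
  by apply: fadj; rewrite hadj.
rewrite -[u]hK -[v]hK /= !kK; apply: (has_walk_homo (h := k)) => // x y xy.
by rewrite -hadj !kK.
Qed.

(** * The glued embedding of the pasted graph *)

Section Pasting.
Variables (G1 G2 : graph) (a1 b1 : G1) (a2 b2 : G2).
Variables (e1 : adj a1 b1) (e2 : adj a2 b2).
Local Notation U := (disjoint_union G1 G2).
Local Notation PG := (pasted_graph e1 e2).
Local Open Scope fset_scope.

Definition pasted_class (x : U) : PG :=
  exist _ (identified a1 b1 a2 b2 x) (ex_intro _ x erefl).

Lemma pasted_class_surj (C : PG) : exists x, C = pasted_class x.
Proof. by case: C => C Cx; have [x xC] := Cx; exists x; apply: eq_exist. Qed.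

Lemma pasted_class_adj : {homo pasted_class : x y / adj x y}.
Proof. by move=> x y xy; apply/asboolP; exists x, y; split=> //=; exact: rst_refl. Qed.

Lemma pasted_class_eq x y :
  identified a1 b1 a2 b2 x y -> pasted_class x = pasted_class y.
Proof.
move=> xy; apply: eq_exist => /=; apply/funext => z; apply/propext; split.
  by apply: rst_trans; exact: rst_sym.
exact: rst_trans.
Qed.

Lemma partial_cube_pasted : partial_cube G1 -> partial_cube G2 -> partial_cube PG.
Proof.
move=> /(partial_cube_edge e1)[X1 [x1 [f1 [isof1 f1a f1b]]]].
move=> /(partial_cube_edge e2)[X2 [x2 [f2 [isof2 f2a f2b]]]].
pose X : choiceType := (X1 + X2)%type.
(* The coordinates [x1] and [x2] are merged by sending both to [inl x1]; [inr x2] is then outside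
   both ranges, so no quotient of the sum is required. *)
pose s1 (y : X1) : X := inl y.
pose s2 (y : X2) : X := if y == x2 then inl x1 else inr y.
have s1_inj : injective s1 by move=> y z [].
have s2_inj : injective s2.
  by move=> y z; rewrite /s2; case: eqP => [->|_]; case: eqP => [->|_] // [].
pose g1 u : hypercube X := s1 @` f1 u.
pose g2 u : hypercube X := s2 @` f2 u.
have /isometric_cubeP[g1adj g1walk] : isometric g1 by exact: isometric_imfset.
have /isometric_cubeP[g2adj g2walk] : isometric g2 by exact: isometric_imfset.
have g1a : g1 a1 = fset0 by rewrite /g1 f1a imfset0.
have g2a : g2 a2 = fset0 by rewrite /g2 f2a imfset0.
have g1b : g1 b1 = [fset inl x1] by rewrite /g1 f1b imfset_fset1.
have g2b : g2 b2 = [fset inl x1] by rewrite /g2 f2b imfset_fset1 /s2 eqxx.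
pose g (x : U) := match x with inl u => g1 u | inr v => g2 v end.
have glueg x y : glue a1 b1 a2 b2 x y -> g x = g y.
  by case=> /=; rewrite ?g1a ?g2a ?g1b ?g2b.
have idg x y : identified a1 b1 a2 b2 x y -> g x = g y.
  by elim=> {x y} // x y z _ -> _ ->.
(* [F] evaluates [g] at a chosen representative; by [idg] the choice does not matter. *)
pose F (C : PG) := g (sval (cid (pasted_class_surj C))).
have FE x : F (pasted_class x) = g x.
  rewrite /F; case: cid => y /= /(congr1 sval) /= xy.
  by apply/esym/idg; rewrite xy; exact: rst_refl.
have c1adj : {homo (fun u : G1 => pasted_class (inl u)) : u v / adj u v}.
  by move=> u v uv; exact: pasted_class_adj.
have c2adj : {homo (fun u : G2 => pasted_class (inr u)) : u v / adj u v}.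
  by move=> u v uv; exact: pasted_class_adj.
have cross u v : has_walk (pasted_class (inl u)) (pasted_class (inr v))
    #|` symdiff (g1 u) (g2 v)|.
  (* [inlr] and [inrl] show that [inl x1] is the only coordinate that [g1 u] and [g2 v] can
     share. *)
  have inlr y : inl y \in g2 v -> y = x1.
    by move=> /imfsetP[z _]; rewrite /s2; case: ifP => // _ [].
  have inrl y : inr y \in g1 u = false by apply/negP => /imfsetP[z _].
  (* If the image of a glued vertex lies between [g1 u] and [g2 v], the walks to it on either side
     concatenate to one of exactly the cube distance. *)
  have through c1 c2 : pasted_class (inl c1) = pasted_class (inr c2) ->
      g1 u `&` g2 v `<=` g1 c1 -> g1 c1 `<=` g1 u `|` g2 v ->
      has_walk (pasted_class (inl u)) (pasted_class (inr v))
        #|` symdiff (g1 u) (g2 v)|.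
    move=> cE uvc cuv; rewrite (card_symdiff_between uvc cuv).
    apply: has_walk_cat (has_walk_homo c1adj (g1walk u c1)) _.
    rewrite cE -[g1 c1]/(g (inl c1)) -FE cE FE.
    exact: has_walk_homo c2adj (g2walk c2 v).
  have [x1u|x1u] := boolP (inl x1 \in g1 u).
    apply: (through b1 b2); first exact/pasted_class_eq/rst_step/glue_b.
      apply/fsubsetP => -[y|y]; rewrite g1b in_fsetI in_fset1 ?inrl //.
      by case/andP=> _ /inlr ->.
    by rewrite g1b fsub1set in_fsetU x1u.
  (* Without [inl x1] in [g1 u], the two images are disjoint, so the empty set lies between them. *)
  apply: (through a1 a2); first exact/pasted_class_eq/rst_step/glue_a.
    apply/fsubsetP => -[y|y]; rewrite in_fsetI ?inrl //.
    by case/andP=> yu /inlr yx; rewrite -yx yu in x1u.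
  by rewrite g1a fsub0set.
exists X, F; apply/isometric_cubeP; split=> [C D /asboolP[x [y [Cx Dy]]]|C D].
  have cl (E : PG) z : sval E z -> F E = g z.
    have [w ->] := pasted_class_surj E; rewrite FE => wz; exact: idg.
  rewrite (cl _ _ Cx) (cl _ _ Dy).
  (* An edge of the disjoint union has both ends on the same side. *)
  by case: x y {Cx Dy} => u [] v //=; [exact: g1adj | exact: g2adj].
have [x ->] := pasted_class_surj C; have [y ->] := pasted_class_surj D.
rewrite !FE; case: x y => [u|u] [v|v] /=.
- exact: has_walk_homo c1adj (g1walk u v).
- exact: cross.
- by apply: has_walk_sym; rewrite /symdiff fsetUC; exact: cross.
- exact: has_walk_homo c2adj (g2walk u v).
Qed.

End Pasting.

Theorem theorem7p4 (G G1 G2 : graph) :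
  partial_cube G1 -> partial_cube G2 -> edge_pasting G G1 G2 -> partial_cube G.
Proof.
move=> pc1 pc2 [_ _ [a1 [b1 [a2 [b2 [e1 [e2 isoG]]]]]]].
exact/(iso_partial_cube isoG)/partial_cube_pasted.
Qed.
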